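(* Let $r\ge 2$ be an integer. Then for every graph $G$: (a) $G\in\mathcal{R}_{1/r}(\mathcal{C})$ if and only if there exists a subgraph $H\subseteq G$ satisfying $r\,e(H)\ge (r+1)v(H)-r$; (b) $G\in\mathcal{M}_{1/r}(\mathcal{C})$ if and only if $r\,e(G)\ge (r+1)v(G)-r$ and $r\,e(H)<(r+1)v(H)-r$ for every proper subgraph $H$ of $G$.
   Context: All graphs (including subgraphs) are finite, simple and have at least one vertex; $v(G)$ and $e(G)$ denote the numbers of vertices and edges of $G$. For an integer $r\ge2$, $\mathcal{R}_{1/r}(\mathcal{C})$ denotes the class of graphs $G$ such that every colouring of $E(G)$ with $r+1$ colours admits a cycle in $G$ (of arbitrary length) whose edges use at most $r$ of the colours. $\mathcal{M}_{1/r}(\mathcal{C})$ is the class of those $G\in\mathcal{R}_{1/r}(\mathcal{C})$ that are minimal with respect to the subgraph relation, i.e. no proper subgraph of $G$ belongs to $\mathcal{R}_{1/r}(\mathcal{C})$. *)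

(* Defs.v *)
From mathcomp Require Import all_boot.

Set Implicit Arguments.
Unset Strict Implicit.
Unset Printing Implicit Defensive.

(* Finite simple graphs whose vertices are drawn from an ambient finite type T.
   The vertex set is a subset of T, so a subgraph is a graph over the same T.
   Both axioms are boolean, so graphs with the same vertices and edges are
   equal. *)
Record graph (T : finType) := Graph {
  vertices : {set T};
  edges : {set {set T}};
  vertices_neq0 : vertices != set0;
  edges_pairs : [forall e in edges, (#|e| == 2) && (e \subset vertices)]
}.

Section Graphs.

Variable T : finType.
Implicit Types G H : graph T.

Definition nb_vertices G : nat := #|vertices G|.
Definition nb_edges G : nat := #|edges G|.

Definition subgraph H G : bool :=
  (vertices H \subset vertices G) && (edges H \subset edges G).

Definition proper_subgraph H G : Prop := subgraph H G /\ H <> G.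

Definition adjacent G : rel T := fun x y => [set x; y] \in edges G.

(* A cycle is given by the list of its vertices in cyclic order. *)
Definition graph_cycle G (p : seq T) : bool :=
  [&& 2 < size p, uniq p & cycle (adjacent G) p].

Definition cycle_edges (p : seq T) : {set {set T}} :=
  [set [set x; next p x] | x in p].

(* A colouring of the edges of G is represented by a function on all of
   {set T}; only its values on the edges of G are ever inspected. *)
Definition in_R (r : nat) G : Prop :=
  forall c : {set T} -> 'I_r.+1,
    exists2 p : seq T, graph_cycle G p & #|c @: cycle_edges p| <= r.

Definition in_M (r : nat) G : Prop :=
  in_R r G /\ forall H, proper_subgraph H G -> ~ in_R r H.

End Graphs.

(* Main.v *)
(** If every class of a colouring has acyclic complement in [H], adding up the
    sizes of these complements gives r e(H) <= (r+1)(v(H)-1), which is the easy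
    direction. For the converse, choose r+1 forests of [G] with every edge in at
    most [r] of them and the sum of their sizes maximum. If each edge lies in
    exactly [r] forests, colour it by the forest that misses it: no cycle avoids
    a colour. Otherwise some edge [e0] lies in fewer than [r] forests; let [D] be
    the set of the edges that become deficient in this way after some sequence of
    exchanges (add a deficient edge to a forest, remove an edge of the cycle it
    closes). Each forest, restricted to [D], connects the ends of every edge of
    [D], so the component of [D] containing [e0] is a subgraph that is too
    dense. This is the exchange proof of Nash-Williams' arboricity theorem,
    applied to the multigraph in which every edge is repeated [r] times. *)

Require Import Defs.
From mathcomp Require Import all_boot.
From mathcomp Require Import zify.

Set Implicit Arguments.
Unset Strict Implicit.
Unset Printing Implicit Defensive.

(** * Connectivity, forests and cycles in sets of edges *)

Section EdgeSets.

Variable T : finType.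
Implicit Types (A B C D : {set {set T}}) (e f : {set T}) (x y u v : T).

Definition joined A : rel T := connect (fun x y => [set x; y] \in A).

(* Acyclicity, as: every edge is a bridge. A singleton in [A] counts as a loop. *)
Definition forest A : bool :=
  [forall x, forall y,
     ([set x; y] \in A) ==> ~~ joined (A :\ [set x; y]) x y].

Lemma forestP A :
  reflect (forall x y, [set x; y] \in A -> ~~ joined (A :\ [set x; y]) x y)
          (forest A).
Proof. by apply: (iffP 'forall_forallP) => h x y; apply/implyP/h. Qed.

Lemma joined_sym A : symmetric (joined A).
Proof. by apply: sym_connect_sym => x y; rewrite setUC. Qed.

Lemma joined_trans A : transitive (joined A).
Proof. exact: connect_trans. Qed.

Lemma joined1 A x y : [set x; y] \in A -> joined A x y.
Proof. by move=> h; apply: connect1. Qed.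

Lemma joined_sub A B :
  (forall x y, [set x; y] \in A -> joined B x y) ->
  forall x y, joined A x y -> joined B x y.
Proof. by move=> h; apply: connect_sub. Qed.

Lemma joinedS A B x y : A \subset B -> joined A x y -> joined B x y.
Proof.
by move=> /subsetP sAB; apply: joined_sub => u v /sAB; apply: joined1.
Qed.

Lemma joined_ind A x (P : T -> Prop) :
  P x -> (forall u v, P u -> [set u; v] \in A -> P v) ->
  forall y, joined A x y -> P y.
Proof.
move=> Px Pstep y /connectP[p]; elim: p x Px => [|z p IHp] x Px /=.
  by move=> _ ->.
by case/andP=> /(Pstep x z Px) Pz; apply: IHp.
Qed.

Lemma set2_eq x y u v :
  [set u; v] = [set x; y] -> (u = x /\ v = y) \/ (u = y /\ v = x).
Proof.
move=> E.
have := set21 u v; have := set22 u v; have := set21 x y; have := set22 x y.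
rewrite E -{1 2}E !inE.
by do 4![case/orP=> /eqP ?]; subst; auto.
Qed.

(** A walk in the enlarged set need cross the new edge at most once, in one of its two
    directions. *)
Lemma joinedU1 A x y u v :
  joined ([set x; y] |: A) u v ->
  [\/ joined A u v, joined A u x /\ joined A y v
    | joined A u y /\ joined A x v].
Proof.
have jx z : joined A z z by exact: connect0.
apply: (joined_ind (P := fun v => [\/ joined A u v,
  joined A u x /\ joined A y v | joined A u y /\ joined A x v])).
  by constructor 1.
move=> {}v w Pv; rewrite !inE => /orP[/eqP/set2_eq[] [vE wE]|/joined1 vw].
- subst v w; case: Pv => [ux|[ux yx]|[uy _]].
  + by constructor 2.
  + by constructor 2.
  + by constructor 1.
- subst v w; case: Pv => [uy|[ux _]|[uy xy]].
  + by constructor 3.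
  + by constructor 1.
  + by constructor 3.
- case: Pv => [uv|[ux yv]|[uy xv]].
  + by constructor 1; apply: joined_trans vw.
  + by constructor 2; split=> //; apply: joined_trans vw.
  + by constructor 3; split=> //; apply: joined_trans vw.
Qed.

Lemma forestS A B : A \subset B -> forest B -> forest A.
Proof.
move=> sAB /forestP fB; apply/forestP=> x y xyA.
apply: contra (fB x y (subsetP sAB _ xyA)).
by apply: joinedS; apply: setSD.
Qed.

(** If some edge [[set u; v]] of [A] stopped being a bridge, the detour between its ends would cross
    the new edge; the rest of that cycle, through [[set u; v]], would join [x] to [y] in [A]. *)
Lemma forestU1 A x y : forest A -> ~~ joined A x y -> forest ([set x; y] |: A).
Proof.
move=> fA nxy; have /forestP bridge := fA; apply/forestP=> u v uvA.
apply/negP=> uv.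
have [E|neq] := eqVneq [set u; v] [set x; y].
  have {}uv : joined A u v.
    by apply: joinedS uv; apply/subsetP=> e; rewrite !inE E => /andP[/negPf->].
  case/set2_eq: E => [] [? ?]; subst u v; first by rewrite uv in nxy.
  by rewrite joined_sym uv in nxy.
have {}uvA : [set u; v] \in A by move: uvA; rewrite !inE (negPf neq).
have sub : A :\ [set u; v] \subset A by exact: subD1set.
have {}uv : joined ([set x; y] |: (A :\ [set u; v])) u v.
  apply: joinedS uv; apply/subsetP=> e; rewrite !inE.
  by case/andP=> ->.
case: (joinedU1 uv) => [|[ux yv]|[uy xv]].
- exact/negP/bridge.
- case/negP: nxy; apply: joined_trans (joinedS sub _) _.
    by rewrite joined_sym; exact: ux.
  apply: joined_trans (joined1 uvA) (joinedS sub _).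
  by rewrite joined_sym.
- case/negP: nxy; apply: joined_trans (joinedS sub xv) _.
  by apply: joined_trans (joinedS sub uy); rewrite joined_sym joined1.
Qed.

(* A minimal subset of the forest joining [x] and [y] is the path between
   them. *)
Lemma joined_bridges A x y :
  forest A -> joined A x y ->
  joined [set e in A | ~~ joined (A :\ e) x y] x y.
Proof.
move=> /forestP fA xy.
pose P C := (C \subset A) && joined C x y.
have [|C /minsetP[/andP[sCA Cxy] minC] _] := @minset_exists _ P A.
  by rewrite /P subxx.
apply: (@joinedS C) => //; apply/subsetP => e eC; rewrite inE (subsetP sCA) //=.
have nCe : ~~ joined (C :\ e) x y.
  apply/negP=> h; have /setP/(_ e) : C :\ e = C.
    by apply: minC; rewrite /P ?h ?(subset_trans (subD1set _ _)) ?subD1set.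
  by rewrite !inE eqxx eC.
apply/negP=> Ae.
have sub u v : joined (C :\ e) u v -> joined (A :\ e) u v.
  by apply: joinedS; apply: setSD.
have [[[u v] E]|noE] := altP (@existsP _ (fun p => e == [set p.1; p.2])).
  move/eqP: E => /= E; subst e.
  (* Without [e] the set [C] no longer joins [x] to [y], so it joins them to opposite ends of [e].
     With the detour [Ae] this joins [u] to [v] in [A :\ e], so [e] would be no bridge. *)
  have := Cxy; rewrite -(setD1K eC) => /joinedU1[h|[xu vy]|[xv uy]].
  - by rewrite h in nCe.
  - case/negP: (fA u v (subsetP sCA _ eC)).
    rewrite joined_sym in xu; rewrite joined_sym in vy.
    by apply: joined_trans (sub _ _ xu) (joined_trans Ae (sub _ _ vy)).
  - case/negP: (fA u v (subsetP sCA _ eC)).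
    rewrite joined_sym in xv.
    apply: joined_trans (sub _ _ uy) _; rewrite joined_sym.
    exact: joined_trans (sub _ _ xv) Ae.
case/negP: nCe; apply: joined_sub Cxy => u v uvC; apply: joined1.
rewrite !inE uvC andbT; apply: contra noE => /eqP E.
by apply/existsP; exists (u, v); rewrite /= E.
Qed.

(** The function [h] labels each vertex by its component, so [#|h @: V|] counts the components on
    [V]. Each added edge either closes a cycle and leaves the components alone, or merges two of
    them; both bounds follow. *)
Lemma component_labels A (V : {set T}) :
  (forall e, e \in A -> #|e| = 2 /\ e \subset V) ->
  exists h : T -> T,
    [/\ forall x y, joined A x y <-> h x = h y,
        #|V| <= #|h @: V| + #|A|
      & forest A -> #|h @: V| + #|A| <= #|V|].
Proof.
have [n leAn] := ubnP #|A|; elim: n A leAn => // n IHn A leAn pairsA.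
have [->|[e eA]] := set_0Vmem A.
  exists id; rewrite imset_id cards0 addn0; split=> // x y.
  split=> [|->]; last first.
    exact: connect0.
  by apply: joined_ind => // u v; rewrite inE.
have [/eqP/cards2P[x [y [neq E]]] sV] := pairsA e eA; subst e.
have cA : #|A| = #|A :\ [set x; y]|.+1 by rewrite (cardsD1 [set x; y] A) eA.
have [|e|h [hP lo up]] := IHn (A :\ [set x; y]); first by rewrite -ltnS -cA.
  by rewrite !inE => /andP[_ /pairsA].
have [xV yV] : x \in V /\ y \in V by rewrite !(subsetP sV) ?set21 ?set22.
have [E|hneq] := eqVneq (h x) (h y).
  have xy : joined (A :\ [set x; y]) x y by apply/hP.
  exists h; split.
  - move=> u v; rewrite -hP; split; last by apply: joinedS; apply: subD1set.
    apply: joined_sub => a b abA.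
    have [/set2_eq[] [-> ->] //|nab] := eqVneq [set a; b] [set x; y].
      by rewrite joined_sym.
    by apply: joined1; rewrite !inE nab.
  - by rewrite cA; lia.
  - by move/forestP/(_ x y eA); rewrite xy.
(* The component of [y] takes over the label of [x], so exactly the label [h y] disappears. *)
pose h' z := if h z == h y then h x else h z.
have imh : h' @: V = (h @: V) :\ h y.
  apply/setP=> z; rewrite !inE; apply/imsetP/andP=> [[a aV ->]|[zy /imsetP[a aV zE]]].
    by rewrite /h'; case: (eqVneq (h a) (h y)) => // na; split=> //; exact: imset_f.
  by exists a => //; rewrite /h' -zE (negPf zy).
have cV : #|h @: V| = #|h' @: V|.+1.
  by rewrite imh (cardsD1 (h y) (h @: V)) imset_f.
exists h'; split.
- have sub u v : h u = h v -> joined A u v.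
    by move/hP; apply: joinedS; apply: subD1set.
  have xy := joined1 eA.
  move=> u v; split.
    apply: (joined_ind (P := fun v => h' u = h' v)) => // a b -> abA.
    rewrite /h'; have [/set2_eq[] [-> ->]|nab] := eqVneq [set a; b] [set x; y].
    + by rewrite eqxx (negPf hneq).
    + by rewrite eqxx (negPf hneq).
    + suff -> : h a = h b by [].
      by apply/hP/joined1; rewrite !inE nab.
  rewrite /h'; case: eqP => [uy|_]; case: eqP => [vy|_].
  + by move=> _; apply: sub; rewrite uy.
  + move/sub=> xv; apply: joined_trans (sub _ _ uy) _.
    by apply: joined_trans xv; rewrite joined_sym.
  + move/sub=> ux; apply: joined_trans ux _; apply: joined_trans xy _.
    exact/sub/esym.
  + exact: sub.
- by rewrite cA; lia.
- move=> fA; have := up (forestS (subD1set _ _) fA); rewrite cA; lia.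
Qed.

Lemma forest_card A (V : {set T}) :
  V != set0 -> (forall e, e \in A -> #|e| = 2 /\ e \subset V) ->
  forest A -> #|A| < #|V|.
Proof.
move=> /set0Pn[x xV] /component_labels[h [_ _ up]] /up.
suff : 0 < #|h @: V| by lia.
by apply/card_gt0P; exists (h x); apply: imset_f.
Qed.

Lemma connected_card A (V : {set T}) x :
  (forall e, e \in A -> #|e| = 2 /\ e \subset V) ->
  (forall y, y \in V -> joined A x y) -> #|V| <= #|A|.+1.
Proof.
move=> /component_labels[h [hP lo _]] conn.
suff : #|h @: V| <= 1 by lia.
rewrite -(cards1 (h x)); apply/subset_leq_card/subsetP => _ /imsetP[y yV ->].
by rewrite inE; apply/eqP/esym/hP/conn.
Qed.

Lemma joined_path A e x p :
  path (fun x y => [set x; y] \in A) x p -> {in p, forall y, y \notin e} ->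
  joined (A :\ e) x (last x p).
Proof.
elim: p x => [|y p IHp] x /=; first by move=> _ _; exact: connect0.
case/andP=> xyA pP out; apply: (@joined_trans _ y); last apply: IHp pP _.
  apply: joined1; rewrite !inE xyA andbT; apply/eqP=> E.
  by have := out y (mem_head _ _); rewrite -E set22.
by move=> z zp; apply: out; rewrite inE zp orbT.
Qed.

(** The remainder of the cycle joins the ends of its first edge, which is therefore no bridge. *)
Lemma forest_cycle A p :
  2 < size p -> uniq p -> cycle (fun x y => [set x; y] \in A) p -> ~~ forest A.
Proof.
case: p => [|x [|y p]] // sp /= /and3P[xnp ynp _].
rewrite rcons_path => /and3P[xyA pP lastA].
apply/negP=> /forestP/(_ x y xyA)/negP[].
have out : {in p, forall z, z \notin [set x; y]}.
  move=> z zp; rewrite !inE negb_or; apply/andP; split; apply/eqP=> E.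
    by move: xnp; rewrite -E inE zp orbT.
  by move: ynp; rewrite -E zp.
rewrite joined_sym; apply: joined_trans (joined_path pP out) (joined1 _).
rewrite !inE lastA andbT; apply/eqP=> E.
(* A cycle has at least three vertices, so the tail [p] is nonempty and the closing edge differs
   from the first one. *)
have lp : last y p \in p by case: (p) sp => //= a q _; rewrite mem_last.
by have := out _ lp; rewrite -E set21.
Qed.

Lemma cycle_of_not_forest A :
  (forall e, e \in A -> #|e| = 2) -> ~~ forest A ->
  exists p, [/\ 2 < size p, uniq p & cycle (fun x y => [set x; y] \in A) p].
Proof.
move=> pairsA; rewrite negb_forall => /existsP[x].
rewrite negb_forall => /existsP[y]; rewrite negb_imply negbK.
case/andP=> xyA /connectP[p0 p0P]; case/shortenP: p0P => p pP up _ E.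
exists (x :: p); split=> //; last first.
  rewrite /= rcons_path -E setUC xyA andbT.
  by apply: sub_path pP => u v; rewrite !inE => /andP[].
(* The path needs an inner vertex: an empty one would make [[set x; y]] a singleton, and a single
   step would be the deleted edge itself. *)
case: p pP up E => [|z [|w p]] //=.
  by move=> _ _ E; have := pairsA _ xyA; rewrite E setUid cards1.
by case/andP=> h _ _ E; move: h; rewrite -E !inE eqxx.
Qed.

End EdgeSets.

(** * Exchanges in a maximum family of [r.+1] forests *)

Section ForestFamilies.

Variables (T : finType) (r : nat) (E : {set {set T}}).
Hypothesis pairsE : forall e, e \in E -> #|e| = 2.

Notation family := {ffun 'I_r.+1 -> {set {set T}}}.
Implicit Types (F : family) (A B : {set {set T}}) (e f : {set T}) (i j : 'I_r.+1).

Definition cover_count F e := #|[set i | e \in F i]|.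

Definition admissible F :=
  [forall i, (F i \subset E) && forest (F i)]
  && [forall e, cover_count F e <= r].

Definition total F := \sum_i #|F i|.

Definition deficient F e := (e \in E) && (cover_count F e < r).

Definition update F i A : family := [ffun j => if j == i then A else F j].

(** Acyclicity of the result encodes that [f] lies on any cycle closed by [e]. *)
Definition exchange F F' :=
  [exists i, exists e, exists f,
     [&& deficient F e, e \notin F i, f \in F i,
         forest (e |: F i :\ f) & F' == update F i (e |: F i :\ f)]].

Lemma exchangeP F F' :
  reflect (exists i e f, [/\ deficient F e, e \notin F i, f \in F i,
             forest (e |: F i :\ f) & F' = update F i (e |: F i :\ f)])
          (exchange F F').
Proof.
apply: (iffP existsP) => [[i /existsP[e /existsP[f]]]|[i [e [f []]]]].
  by case/and5P=> ? ? ? ? /eqP ?; exists i, e, f.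
move=> ? ? ? ? ->; exists i; apply/existsP; exists e; apply/existsP; exists f.
by apply/and5P; split.
Qed.

Lemma admissibleP F :
  reflect [/\ forall i, F i \subset E, forall i, forest (F i)
            & forall e, cover_count F e <= r]
          (admissible F).
Proof.
apply: (iffP andP) => [[/forallP h /forallP le]|[sE fF le]].
  by split=> // i; case/andP: (h i).
by split; apply/forallP=> // i; rewrite sE fF.
Qed.

Lemma cover_count_update F i A e :
  cover_count (update F i A) e + (e \in F i) = cover_count F e + (e \in A).
Proof.
rewrite /cover_count (cardsD1 i [set j | e \in update F i A j]).
rewrite (cardsD1 i [set j | e \in F j]) !inE ffunE eqxx.
suff -> : [set j | e \in update F i A j] :\ i = [set j | e \in F j] :\ i by lia.
by apply/setP=> j; rewrite !inE ffunE; case: eqP.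
Qed.

Lemma total_update F i A : total (update F i A) + #|F i| = total F + #|A|.
Proof.
rewrite /total (bigD1 i) //= [in RHS](bigD1 i) //= ffunE eqxx.
rewrite (eq_bigr (fun j => #|F j|)); first by rewrite addnC [#|A| + _]addnC addnA.
by move=> j /negPf ji; rewrite ffunE ji.
Qed.

(** Only edges new to the set of index [i] gain a cover, and being deficient they have room for
    it. *)
Lemma admissible_update F i A :
  admissible F -> A \subset E -> forest A ->
  (forall e, e \in A -> e \notin F i -> deficient F e) ->
  admissible (update F i A).
Proof.
move=> /admissibleP[sE fF le] sA fA new; apply/admissibleP.
split=> [j|j|e]; try by rewrite ffunE; case: eqP.
have := cover_count_update F i A e; have := le e; have := new e.
case: (e \in A) => [|_ ? /=]; last by lia.
by case: (e \in F i) => [_ ? /=|/(_ isT isT)/andP[_ ?] _ /=]; lia.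
Qed.

Lemma exchange_admissible F F' :
  admissible F -> exchange F F' -> admissible F' /\ total F' = total F.
Proof.
move=> adm /exchangeP[i [e [f [/[dup] def /andP[eE _] ei fi fo ->]]]].
have [sE _ _] := admissibleP _ adm; split.
  apply: admissible_update => //.
    rewrite subUset sub1set eE; exact: subset_trans (subD1set _ _) (sE i).
  by move=> g; rewrite !inE => /orP[/eqP->//|/andP[_ ->]].
have := total_update F i (e |: F i :\ f).
by rewrite cardsU1 !inE (negPf ei) andbF (cardsD1 f (F i)) fi => /addIn.
Qed.

Variable F0 : family.
Hypothesis F0adm : admissible F0.
Hypothesis F0max : forall F, admissible F -> total F <= total F0.

Definition exchange_deficient : {set {set T}} :=
  [set e | [exists F, connect exchange F0 F && deficient F e]].
Local Notation D := exchange_deficient.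

(** Exchanges preserve [total], so every reachable family is again of maximum total: maximality can
    be used at [F] and not only at [F0]. *)
Lemma reachable_admissible F :
  connect exchange F0 F -> admissible F /\ total F = total F0.
Proof.
case/connectP=> p; elim/last_ind: p F => [|p F' IHp] F /=; first by move=> _ ->.
rewrite rcons_path last_rcons => /andP[pP ex] ->.
have [adm <-] := IHp _ pP (erefl _); exact: exchange_admissible ex.
Qed.

(** When [[set x; y]] is not in [F i], each edge on the path of [F i] between its ends can be
    exchanged for it and becomes deficient, so the whole path lies in [D]. *)
Lemma deficient_joined F i x y :
  connect exchange F0 F -> deficient F [set x; y] -> joined (F i :&: D) x y.
Proof.
move=> reach def; have [adm tot] := reachable_admissible reach.
have [sE fF le] := admissibleP _ adm.
have [xyF|xyF] := boolP ([set x; y] \in F i).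
  apply: joined1; rewrite in_setI xyF inE.
  by apply/existsP; exists F; rewrite reach.
have xyE : [set x; y] \in E by case/andP: def.
have Fxy : joined (F i) x y.
  (* Otherwise [[set x; y]] could be added to [F i], raising the maximum total. *)
  apply/negPn/negP=> nxy.
  have /F0max : admissible (update F i ([set x; y] |: F i)).
    apply: admissible_update => //; first by rewrite subUset sub1set xyE sE.
      exact: forestU1.
    by move=> e; rewrite !inE => /orP[/eqP->//|->].
  have := total_update F i ([set x; y] |: F i).
  by rewrite cardsU1 xyF -tot; lia.
apply: joinedS (joined_bridges (fF i) Fxy); apply/subsetP=> f.
rewrite inE => /andP[fF' br]; rewrite in_setI fF' inE; apply/existsP.
have fne : f != [set x; y] by apply: contraNneq xyF => <-.
exists (update F i ([set x; y] |: F i :\ f)); apply/andP; split.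
  apply: connect_trans reach (connect1 _); apply/exchangeP.
  exists i, [set x; y], f; split=> //; apply: forestU1 => //.
  exact: forestS (subD1set _ _) (fF i).
(* The edge [f] was covered at most [r] times and has just lost one cover. *)
rewrite /deficient (subsetP (sE i)) //=.
have := cover_count_update F i ([set x; y] |: F i :\ f) f.
by rewrite !inE (negPf fne) eqxx fF' /=; have := le f; lia.
Qed.

(** Exchanges are undone one at a time. The only edge new to the altered forest was deficient in the
    preceding family, where its ends are thus already joined within [D]. *)
Lemma reachable_joined F i x y :
  connect exchange F0 F -> joined (F i :&: D) x y -> joined (F0 i :&: D) x y.
Proof.
case/connectP=> p; elim/last_ind: p F x y => [|p F' IHp] F x y /=.
  by move=> _ ->.
rewrite rcons_path last_rcons => /andP[pP ex] -> xy.
have reach : connect exchange F0 (last F0 p) by apply/connectP; exists p.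
apply: (IHp _ _ _ pP (erefl _)); move: ex xy.
set F1 := last F0 p => /exchangeP[j [e [f [def _ _ _ ->]]]].
apply: joined_sub => u v; rewrite in_setI ffunE.
have [->|ji] := eqVneq i j; last first.
  by rewrite -in_setI; apply: joined1.
rewrite in_setU1 => /andP[/orP[/eqP uve _|]].
  by apply: deficient_joined reach _; rewrite uve.
by rewrite in_setD1 => /andP[_ uvF] uvD; apply: joined1; rewrite in_setI uvF.
Qed.

Lemma exchange_deficient_joined i x y :
  [set x; y] \in D -> joined (F0 i :&: D) x y.
Proof.
rewrite inE => /existsP[F /andP[reach def]].
exact: reachable_joined reach (deficient_joined _ reach def).
Qed.

Lemma sum_cover_count B :
  \sum_i #|F0 i :&: B| = \sum_(e in B) cover_count F0 e.
Proof.
under eq_bigr do rewrite -sum1_card.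
under [RHS]eq_bigr do rewrite /cover_count -sum1_card.
rewrite (exchange_big_dep (mem B)) /= => [|i e _]; last by rewrite inE => /andP[].
apply: eq_bigr => e eB; apply: eq_bigl => i.
by rewrite !inE eB andbT.
Qed.

(** Take for [U] the component of [x0] in [D] and for [B] the edges of [D] inside it. All [r.+1]
    forests connect [U] within [B], while no edge lies in more than [r] of them. *)
Lemma deficient_dense x0 y0 :
  deficient F0 [set x0; y0] ->
  exists (U : {set T}) (B : {set {set T}}),
    [/\ x0 \in U, U :\ x0 \subset cover E, B \subset E,
        forall e, e \in B -> e \subset U
      & r.+1 * #|U| - r <= r * #|B|].
Proof.
move=> def; have [sE fF le] := admissibleP _ F0adm.
pose U := [set z | joined D x0 z]; pose B := [set e in D | e \subset U].
have sD : D \subset E.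
  by apply/subsetP=> e; rewrite inE => /existsP[F /and3P[]].
have sB : B \subset E.
  by apply/subsetP=> e; rewrite inE => /andP[/(subsetP sD)].
have xyD : [set x0; y0] \in D.
  by rewrite inE; apply/existsP; exists F0; rewrite connect0.
have stepU u v : u \in U -> [set u; v] \in D -> v \in U.
  by rewrite [u \in U]inE [v \in U]inE => xu uv; apply: joined_trans xu (joined1 uv).
have x0U : x0 \in U by rewrite inE; exact: connect0.
have xyB : [set x0; y0] \in B.
  by rewrite inE xyD subUset !sub1set x0U (stepU x0).
have subU i e : e \in F0 i :&: B -> #|e| = 2 /\ e \subset U.
  case/setIP=> eF; rewrite inE => /andP[_ ->]; split=> //.
  exact/pairsE/(subsetP (sE i)).
(* A walk in [D] from [x0] never leaves [U], so its edges are in [B]. *)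
have conn i z : z \in U -> joined (F0 i :&: B) x0 z.
  rewrite inE => /(joined_sub (exchange_deficient_joined i)) h.
  suff [] : z \in U /\ joined (F0 i :&: B) x0 z by [].
  move: z h; apply: joined_ind; first by split=> //; exact: connect0.
  move=> u v [uU xu] /setIP[uvF uvD]; have vU := stepU u v uU uvD.
  split=> //; apply: joined_trans xu (joined1 _).
  by rewrite in_setI uvF inE uvD subUset !sub1set uU.
exists U, B; split=> //.
- apply/subsetP=> z; rewrite in_setD1 inE => /andP[zx xz].
  have [//|] : z = x0 \/ z \in cover E; last by [].
    move: z xz {zx}; apply: joined_ind; first by left.
    move=> u v _ uv; right; apply/bigcupP; exists [set u; v].
      exact: subsetP sD _ uv.
    by rewrite set22.
  by move=> zE; rewrite zE eqxx in zx.
- by move=> e; rewrite inE => /andP[].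
have lower : r.+1 * #|U|.-1 <= \sum_i #|F0 i :&: B|.
  rewrite -[X in X * _](card_ord r.+1) -sum_nat_const; apply: leq_sum => i _.
  by have := connected_card (@subU i) (@conn i); lia.
(* Strictness comes from [[set x0; y0]], covered fewer than [r] times; this extra one turns
   [r.+1 * #|U|.-1] into [r.+1 * #|U| - r]. *)
have upper : \sum_i #|F0 i :&: B| < r * #|B|.
  rewrite sum_cover_count mulnC -sum_nat_const.
  rewrite (bigD1 [set x0; y0]) //= [ltnRHS](bigD1 [set x0; y0]) //= -addSn.
  by apply: leq_add; [case/andP: def | apply: leq_sum].
have U0 : 0 < #|U| by apply/card_gt0P; exists x0.
nia.
Qed.

End ForestFamilies.

(** * Dense subgraphs and cycles that miss a colour *)

Section Graphs.

Variables (T : finType) (r : nat).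
Implicit Types G H K : graph T.

Lemma edge_pair G e : e \in edges G -> #|e| = 2 /\ e \subset vertices G.
Proof.
by move=> eG; have /forall_inP/(_ e eG)/andP[/eqP] := edges_pairs G.
Qed.

Lemma graph_eq G H : vertices G = vertices H -> edges G = edges H -> G = H.
Proof.
case: G H => [V E p q] [V' E' p' q'] /= eV eE; subst V' E'.
by rewrite (bool_irrelevance p p') (bool_irrelevance q q').
Qed.

Lemma subgraph_trans G H K : subgraph K H -> subgraph H G -> subgraph K G.
Proof.
move=> /andP[a b] /andP[c d].
by rewrite /subgraph (subset_trans a c) (subset_trans b d).
Qed.

Lemma subgraph_anti G H : subgraph H G -> subgraph G H -> H = G.
Proof.
by move=> /andP[a b] /andP[c d]; apply: graph_eq; apply/eqP; rewrite eqEsubset ?a ?b.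
Qed.

Lemma dense_in_R G H :
  subgraph H G -> r.+1 * nb_vertices H - r <= r * nb_edges H -> in_R r G.
Proof.
move=> /andP[_ sHG] dense c.
pose A (i : 'I_r.+1) := [set e in edges H | c e != i].
have [/existsP[i nf]|/existsPn allf] := boolP [exists i, ~~ forest (A i)].
  have [|p [sp up cp]] := cycle_of_not_forest _ nf.
    by move=> e; rewrite inE => /andP[/edge_pair[]].
  exists p.
    apply/and3P; split=> //; apply: sub_cycle cp => x y; rewrite inE.
    by case/andP=> /(subsetP sHG).
  rewrite -ltnS -[ltnRHS]card_ord -cardsT; apply: proper_card.
  apply/properP; split; first exact: subsetT.
  exists i => //; apply/imsetP=> -[_ /imsetP[x xp ->] E].
  by have := next_cycle cp xp; rewrite inE -E eqxx andbF.
have small i : #|A i| < #|vertices H|.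
  apply: forest_card (vertices_neq0 H) _ (negPn (allf i)) => e.
  by rewrite inE => /andP[/edge_pair].
have count : \sum_i #|A i| = r * nb_edges H.
  under eq_bigr do rewrite -sum1_card.
  rewrite (exchange_big_dep (mem (edges H))) /= => [|i e _]; last first.
    by rewrite inE => /andP[].
  rewrite mulnC /nb_edges -sum_nat_const; apply: eq_bigr => e eH.
  (* An edge lies in every [A i] except the one indexed by its own colour. *)
  rewrite (eq_bigl (mem [set~ c e])) => [|i].
    by rewrite sum1_card cardsC1 card_ord.
  by rewrite !inE eH eq_sym.
have : \sum_i #|A i| <= r.+1 * #|vertices H|.-1.
  rewrite -[X in X * _](card_ord r.+1) -sum_nat_const; apply: leq_sum => i _.
  by have := small i; lia.
rewrite count; move: dense; rewrite /nb_vertices.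
have : 0 < #|vertices H| by rewrite card_gt0 vertices_neq0.
nia.
Qed.

Lemma in_R_dense G :
  0 < r -> in_R r G ->
  exists2 H, subgraph H G & r.+1 * nb_vertices H - r <= r * nb_edges H.
Proof.
move=> r0 GR; pose E := edges G.
have adm0 : admissible E ([ffun=> set0] : {ffun 'I_r.+1 -> {set {set T}}}).
  apply/admissibleP; split=> [i|i|e]; rewrite ?ffunE ?sub0set //.
    by apply/forestP=> x y; rewrite inE.
  by rewrite /cover_count eq_card0 // => i; rewrite !inE ffunE inE.
case: (arg_maxnP (@total T r) adm0) => F Fadm Fmax.
have [sE fF _] := admissibleP _ _ Fadm.
have [/existsP[e def]|/existsPn full] := boolP [exists e, deficient E F e].
  have eE : e \in E by case/andP: def.
  have [/eqP/cards2P[x [y [_ eq_e]]] sV] := edge_pair eE; subst e.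
  have pairsE e : e \in E -> #|e| = 2 by case/edge_pair.
  have [U [B [xU sU sB BU dense]]] := deficient_dense pairsE Fadm Fmax def.
  have U0 : U != set0 by apply/set0Pn; exists x.
  have BP : [forall e in B, (#|e| == 2) && (e \subset U)].
    by apply/forall_inP=> e eB; rewrite BU // pairsE ?eqxx // (subsetP sB).
  exists (Graph U0 BP) => //; apply/andP; split=> //=.
  rewrite -(setD1K xU) subUset sub1set (subsetP sV) ?set21 //.
  apply: subset_trans sU _; apply/bigcupsP=> e eG.
  by case: (edge_pair eG).
(* The default [ord0] is never reached: an admissible family has [r.+1] members, at most [r] of
   which contain [e]. *)
pose c e := odflt ord0 [pick i | e \notin F i].
have [p /and3P[sp up cp] few] := GR c.
have [j jP] : exists j, j \notin c @: cycle_edges p.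
  apply/existsP; rewrite -negb_forall; apply: contraL few => /forallP all.
  rewrite -ltnNge -[leqLHS]card_ord -cardsT.
  by apply/subset_leq_card/subsetP.
suff /(forest_cycle sp up) : cycle (fun x y => [set x; y] \in F j) p.
  by rewrite fF.
apply: cycle_from_next => // x xp; apply: contraNT jP => nF.
apply/imsetP; exists [set x; next p x]; first exact: imset_f.
set e := [set _; _] in nF *.
have eE : e \in E by exact: next_cycle cp xp.
rewrite /c; case: pickP => [i ni|/(_ j)]; last by rewrite nF.
(* Both [F i] and [F j] miss [e]; if [i] and [j] differed, at most [r.-1] forests would contain [e]
   and it would be deficient. *)
apply/eqP; apply: contraNT (full e) => ij; rewrite /deficient eE /=.
have : #|[set k | e \in F k]| <= #|[set~ i] :\ j|.
  apply/subset_leq_card/subsetP=> k; rewrite !inE => ke.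
  by apply/andP; split; [apply: contraNneq nF | apply: contraNneq ni] => <-.
have := cardsD1 j [set~ i]; rewrite cardsC1 card_ord !inE ij /cover_count /=.
lia.
Qed.

End Graphs.

(* The natural-number subtractions never truncate: a graph has at least one
   vertex, so r <= r.+1 * nb_vertices H. *)
Theorem theorem1p5 (r : nat) (hr : 2 <= r) (T : finType) (G : graph T) :
  (in_R r G <->
     exists2 H : graph T, subgraph H G
       & r * nb_edges H >= r.+1 * nb_vertices H - r)
  /\
  (in_M r G <->
     r * nb_edges G >= r.+1 * nb_vertices G - r
     /\ forall H : graph T, proper_subgraph H G ->
          r * nb_edges H < r.+1 * nb_vertices H - r).
Proof.
have r0 : 0 < r by exact: ltnW.
have refl (H : graph T) : subgraph H H by rewrite /subgraph !subxx.
split; first by split=> [/(in_R_dense r0)|[H]] //; exact: dense_in_R.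
split=> [[GR minG]|[dense sparse]].
  split=> [|H propH].
    have [H sHG dense] := in_R_dense r0 GR.
    (* Whether [H] equals [G] is decided by the converse inclusion. If it fails, [H] is a proper
       subgraph in the class, against minimality. *)
    have [sGH|nsGH] := boolP (subgraph G H); first by rewrite -(subgraph_anti sHG sGH).
    case: (minG H _ (dense_in_R (refl H) dense)).
    by split=> // E; rewrite E refl in nsGH.
  by rewrite ltnNge; apply/negP=> /(dense_in_R (refl H)); exact: minG.
(* The dense subgraph [K] found in a proper subgraph [H] is itself proper in [G], which contradicts
   [sparse]. *)
split=> [|H [sHG neq] /(in_R_dense r0)[K sKH]]; first exact: dense_in_R (refl G) dense.
apply/negP; rewrite -ltnNge; apply: sparse; split.
  exact: subgraph_trans sKH sHG.
by move=> E; apply: neq; apply: subgraph_anti => //; rewrite -E.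
Qed.
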